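(* Let $W\in\mathbb{R}^{n\times n}$ be symmetric positive definite and $T\in\mathbb{R}^{n\times n}$ be symmetric positive semidefinite, and let $0<\nu_1\le\nu_2\le\cdots\le\nu_n$ and $0\le\mu_1\le\mu_2\le\cdots\le\mu_n\neq 0$ be the eigenvalues of $W$ and $T$, respectively. Let $(\lambda_k,u_k)$, $u_k=(x_k;y_k)$, be the eigenpairs of $\mathcal{G}_\alpha^{-1}\mathcal{A}$, with associated numbers $a_k,b_k,c_k$ (matrices, eigenpairs and numbers as defined in the context). If $\alpha$ satisfies $$0<\alpha\le \min\left\{\frac{2}{b_k}\left(\sqrt{a_k(a_k+c_k)}-a_k\right):\ b_k\neq 0\right\},$$ the minimum being over those eigenpairs with $y_k\neq0$ and $b_k\ne0$, then every eigenvalue $\lambda$ of $\mathcal{G}_\alpha^{-1}\mathcal{A}$ lies in the disk $$|\lambda-1|\le\sqrt{\frac{\mu_n^3\nu_n^2-\alpha\,\mu_1^2\nu_1^2}{\nu_1^2\,\nu_n^2\,\mu_1}},$$ where the right-hand side is read as $+\infty$ if $\mu_1=0$.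
   Context: For $W,T\in\mathbb{R}^{n\times n}$ and $\alpha>0$ define the $2n\times 2n$ real block matrices $$\mathcal{A}=\begin{bmatrix} W & -T\\ T & W\end{bmatrix},\qquad \mathcal{G}_\alpha=\begin{bmatrix} W & 0\\ \alpha I & W\end{bmatrix},$$ where $I$ is the $n\times n$ identity. Eigenvalues and eigenvectors are taken over $\mathbb{C}$. The eigenpairs $(\lambda_k,u_k)$ of $\mathcal{G}_\alpha^{-1}\mathcal{A}$ form a finite list in which every eigenvalue occurs with at least one eigenvector $u_k=(x_k;y_k)\neq 0$, $x_k,y_k\in\mathbb{C}^n$ (the vector obtained by stacking $x_k$ on top of $y_k$). For each $k$ with $y_k\ne0$ set $$a_k=\frac{y_k^{*}Ty_k}{y_k^*y_k},\quad b_k=\frac{y_k^{*}TW^{-2}Ty_k}{y_k^*y_k},\quad c_k=\frac{y_k^{*}TW^{-1}TW^{-1}Ty_k}{y_k^*y_k},$$ where $*$ denotes conjugate transpose; these are nonnegative real numbers. If no eigenpair has $y_k\neq0$ and $b_k\ne 0$, the upper bound on $\alpha$ is void. *)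

(* Defs.v *)
(* R is an arbitrary realType standing for the real line, and R[i] stands for
   the complex numbers. *)
From HB Require Import structures.
From mathcomp Require Import all_boot all_order all_algebra.
From mathcomp Require Import spectral complex.
From mathcomp Require Import constructive_ereal reals.
Set Implicit Arguments.
Unset Strict Implicit.
Unset Printing Implicit Defensive.
Import Order.TTheory GRing.Theory Num.Theory.
Local Open Scope ring_scope.
Local Open Scope sesquilinear_scope.
Local Open Scope complex_scope.

Definition spdmx (R : realType) (n : nat) (M : 'M[R]_n) : Prop :=
  M^T = M /\ forall x : 'cV[R]_n, x != 0 -> 0 < (x^T *m M *m x) 0 0.

Definition spsdmx (R : realType) (n : nat) (M : 'M[R]_n) : Prop :=
  M^T = M /\ forall x : 'cV[R]_n, 0 <= (x^T *m M *m x) 0 0.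

(* [ev] lists the eigenvalues of [M], with multiplicity, in nondecreasing
   order. *)
Definition ordered_eigenvalues (R : realType) (n : nat) (M : 'M[R]_n)
    (ev : 'I_n -> R) : Prop :=
  char_poly M = \prod_(i < n) ('X - (ev i)%:P) /\
  forall i j : 'I_n, (i <= j)%N -> ev i <= ev j.

(* Eigenvectors are columns here, whereas the library's [eigenvalue] and
   [eigenspace] are about rows. *)
Definition is_eigenpair (F : fieldType) (n : nat) (M : 'M[F]_n)
    (p : F * 'cV[F]_n) : Prop :=
  p.2 != 0 /\ M *m p.2 = p.1 *: p.2.

Definition is_eigenvalue (F : fieldType) (n : nat) (M : 'M[F]_n) (l : F)
    : Prop :=
  exists u : 'cV[F]_n, is_eigenpair M (l, u).

(* A finite list of eigenpairs of [M] in which every eigenvalue of [M] occurs;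
   several eigenvectors for the same eigenvalue are allowed. *)
Definition eigenpair_list (F : fieldType) (n : nat) (M : 'M[F]_n)
    (s : seq (F * 'cV[F]_n)) : Prop :=
  (forall p, p \in s -> is_eigenpair M p) /\
  (forall l, is_eigenvalue M l -> exists2 p, p \in s & p.1 = l).

Definition complexmx (R : realType) (m n : nat) (M : 'M[R]_(m, n))
    : 'M[R[i]]_(m, n) :=
  map_mx (real_complex R) M.

Section Preconditioner.
Variables (R : realType) (n : nat) (W T : 'M[R]_n) (alpha : R).

Definition calA : 'M[R]_(n + n) := block_mx W (- T) T W.

Definition calG : 'M[R]_(n + n) := block_mx W 0 (alpha *: 1%:M) W.

Definition precond : 'M[R[i]]_(n + n) := complexmx (invmx calG *m calA).

End Preconditioner.

(* For a symmetric [M] the quotient is a real number, so that taking its real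
   part only changes its type. *)
Definition rayleigh (R : realType) (n : nat) (M : 'M[R]_n) (y : 'cV[R[i]]_n)
    : R :=
  complex.Re ((y^t* *m complexmx M *m y) 0 0 / (y^t* *m y) 0 0).

Section Coefficients.
Variables (R : realType) (n : nat) (W T : 'M[R]_n) (y : 'cV[R[i]]_n).

Definition coef_a : R := rayleigh T y.

Definition coef_b : R := rayleigh (T *m (invmx W *m invmx W) *m T) y.

Definition coef_c : R :=
  rayleigh (T *m invmx W *m T *m invmx W *m T) y.

Definition alpha_bound : R :=
  2 / coef_b * (Num.sqrt (coef_a * (coef_a + coef_c)) - coef_a).

End Coefficients.

(* The minimum of the bounds over the eigenpairs (l, (x; y)) in [s] with
   y <> 0 and b <> 0; it is +oo when there is no such eigenpair. *)
Definition alpha_max (R : realType) (n : nat) (W T : 'M[R]_n)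
    (s : seq (R[i] * 'cV[R[i]]_(n + n))) : \bar R :=
  \big[Order.min/+oo%E]_(p <- s |
      (dsubmx p.2 != 0) && (coef_b W T (dsubmx p.2) != 0))
    (alpha_bound W T (dsubmx p.2))%:E.

(* The arguments are the extreme eigenvalues nu_1, nu_n of W and mu_1, mu_n of
   T. *)
Definition disk_radius (R : realType) (alpha nu1 nun mu1 mun : R) : \bar R :=
  if mu1 == 0 then +oo%E
  else (Num.sqrt ((mun ^+ 3 * nun ^+ 2 - alpha * mu1 ^+ 2 * nu1 ^+ 2)
                  / (nu1 ^+ 2 * nun ^+ 2 * mu1)))%:E.

(* Main.v *)
(* Let [theta = lambda - 1] be nonzero and [w = W^-1 T y].  The eigenvector
   equation gives [a theta^2 - alpha b theta + (c - alpha b) = 0], with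
   [a |y|^2 = y^* T y], [b |y|^2 = |w|^2] and [c |y|^2 = w^* T w].  The bound on
   [alpha] makes the discriminant nonpositive, so
   [|theta|^2 = (c - alpha b) / a]; the extreme eigenvalues of [T] and [W]
   then bound [a], [b] and [c]. *)
Require Import Defs.
From HB Require Import structures.
From mathcomp Require Import all_boot all_order all_algebra.
From mathcomp Require Import spectral complex.
From mathcomp Require Import constructive_ereal reals.
From mathcomp Require Import ring lra.
Set Implicit Arguments.
Unset Strict Implicit.
Unset Printing Implicit Defensive.
Import Order.TTheory GRing.Theory Num.Theory.
Local Open Scope ring_scope.
Local Open Scope complex_scope.
Local Open Scope sesquilinear_scope.

(** * The Hermitian inner product on complex columns *)

Section DotProduct.
Variable C : numClosedFieldType.

Definition dot n (u v : 'cV[C]_n) : C := (u^t* *m v) 0 0.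

Lemma dotE n (u v : 'cV[C]_n) : dot u v = \sum_i (u i 0)^* * v i 0.
Proof. by rewrite /dot mxE; apply: eq_bigr => i _; rewrite !mxE. Qed.

Lemma dotDr n (u v w : 'cV[C]_n) : dot u (v + w) = dot u v + dot u w.
Proof. by rewrite /dot mulmxDr mxE. Qed.

Lemma dotZr n (u v : 'cV[C]_n) k : dot u (k *: v) = k * dot u v.
Proof. by rewrite /dot -scalemxAr mxE. Qed.

Lemma dotNr n (u v : 'cV[C]_n) : dot u (- v) = - dot u v.
Proof. by rewrite -scaleN1r dotZr mulN1r. Qed.

Lemma dot_ge0 n (u : 'cV[C]_n) : 0 <= dot u u.
Proof.
by rewrite dotE; apply: sumr_ge0 => i _; rewrite mulrC -normCK exprn_ge0.
Qed.

Lemma dot_gt0 n (u : 'cV[C]_n) : u != 0 -> 0 < dot u u.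
Proof.
move=> u0; rewrite lt0r dot_ge0 andbT; apply: contraNneq u0 => /eqP.
rewrite dotE psumr_eq0 => [/allP h|i _]; last first.
  by rewrite mulrC -normCK exprn_ge0.
apply/eqP/colP => i; rewrite mxE.
have := h i (mem_index_enum _); rewrite implyTb mulrC -normCK expf_eq0 /=.
by rewrite normr_eq0 => /eqP.
Qed.

Lemma dot_mull n (M : 'M[C]_n) u v : dot (M *m u) v = dot u (M^t* *m v).
Proof. by rewrite /dot trmx_mul map_mxM mulmxA. Qed.

Lemma dot_unitary n (P : 'M[C]_n) u v :
  P \is unitarymx -> dot (P *m u) (P *m v) = dot u v.
Proof.
move=> uP; rewrite dot_mull mulmxA -[in RHS](mul1mx v).
by rewrite -(invmx_unitary uP) mulVmx // unitarymx_unit.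
Qed.

Lemma dot_diag_bounds n (r : 'rV[C]_n) (lo hi : C) z :
  (forall i, lo <= r 0 i <= hi) ->
  lo * dot z z <= dot z (diag_mx r *m z) <= hi * dot z z.
Proof.
move=> rb.
rewrite !dotE !mulr_sumr; apply/andP; split; apply: ler_sum => i _;
  have /andP[lb ub] := rb i;
  rewrite mul_diag_mx mxE [_ * (r _ _ * _)]mulrCA;
  by apply: ler_wpM2r => //; rewrite mulrC -normCK exprn_ge0.
Qed.

End DotProduct.

(** * Quadratic forms of real symmetric matrices on complex vectors *)

Section Symmetric.
Variables (R : realType) (n : nat).
Implicit Types (M : 'M[R]_n.+1) (ev : 'I_n.+1 -> R).

Lemma real_complexM (x y : R) : (x * y)%:C = x%:C * y%:C.
Proof. exact: rmorphM. Qed.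

Lemma complexmxM M M' : complexmx (M *m M') = complexmx M *m complexmx M'.
Proof. exact: map_mxM. Qed.

Lemma complexmx_herm M : M^T = M -> (complexmx M)^t* = complexmx M.
Proof.
move=> sM; apply/matrixP => i j; rewrite !mxE -[in RHS]sM mxE.
exact: conjc_real.
Qed.

Lemma dot_herm M u v : M^T = M ->
  dot (complexmx M *m u) v = dot u (complexmx M *m v).
Proof. by move=> sM; rewrite dot_mull complexmx_herm. Qed.

(** Over the complex numbers [M] is Hermitian, hence normal, and the spectral theorem diagonalizes
    it. Each diagonal entry is a root of the characteristic polynomial, so it is one of the real
    [ev j]. The extreme values suffice for the estimates, so multiplicities are not tracked. *)
Lemma symmetric_diagonalization M ev :
  M^T = M -> ordered_eigenvalues M ev ->
  exists P : 'M[R[i]]_n.+1, exists d : 'I_n.+1 -> R,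
    [/\ P \is unitarymx,
        complexmx M = P^t* *m diag_mx (\row_i (d i)%:C) *m P
      & forall i, ev ord0 <= d i <= ev ord_max].
Proof.
move=> sM [charM ordM].
have nM : complexmx M \is normalmx by apply/normalmxP; rewrite complexmx_herm.
have /orthomx_spectralP := nM.
set P := spectralmx _; set r := spectral_diag _ => MP.
have uP : P \is unitarymx by exact: spectral_unitarymx.
have Pu := unitarymx_unit uP; clearbody P r.
have evr i : {j | r 0 i = (ev j)%:C}.
  apply: sig_eqW.
  have : eigenvalue (complexmx M) (r 0 i).
    (* The rows of [P] are left eigenvectors. None vanishes, since otherwise the diagonal entry of
       [P *m invmx P] in that row would be 0 instead of 1. *)
    apply/eigenvalueP; exists (row i P).
      rewrite {1}MP -row_mul -!mulmxA mulKVmx // row_mul row_diag_mx.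
      by rewrite -scalemxAl -rowE.
    apply: contraTneq Pu => P0.
    apply/negP => /mulmxV/(congr1 (row i)).
    rewrite row_mul P0 mul0mx => /rowP/(_ i)/eqP.
    by rewrite !mxE eqxx eq_sym oner_eq0.
  rewrite eigenvalue_root_char -map_char_poly charM rmorph_prod /=.
  rewrite /root horner_prod prodf_seq_eq0 => /hasP[j _ /=].
  rewrite rmorphB /= map_polyX map_polyC hornerXsubC subr_eq0 => /eqP.
  by exists j.
exists P, (fun i => ev (sval (evr i))); split=> //.
  suff -> : \row_i (ev (sval (evr i)))%:C = r by rewrite -(invmx_unitary uP).
  by apply/rowP => i; rewrite mxE; apply/esym; exact: svalP (evr i).
by move=> i; rewrite !ordM //= -ltnS.
Qed.

Lemma rayleigh_bounds M ev y : M^T = M -> ordered_eigenvalues M ev ->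
  (ev ord0)%:C * dot y y <= dot y (complexmx M *m y)
    <= (ev ord_max)%:C * dot y y.
Proof.
move=> sM evM; have [P [d [uP MP db]]] := symmetric_diagonalization sM evM.
have -> : dot y (complexmx M *m y) =
    dot (P *m y) (diag_mx (\row_i (d i)%:C) *m (P *m y)).
  by rewrite dot_mull MP !mulmxA.
rewrite -(dot_unitary y y uP).
by apply: dot_diag_bounds => i; rewrite mxE !lecR.
Qed.

(** In the eigenbasis the squared norm of [M y] weights the coordinates of [y] by [d i ^+ 2];
    squaring preserves the bounds on [d i] because the spectrum is nonnegative. *)
Lemma norm_mul_bounds M ev y : M^T = M -> ordered_eigenvalues M ev ->
    0 <= ev ord0 ->
  (ev ord0 ^+ 2)%:C * dot y y <= dot (complexmx M *m y) (complexmx M *m y)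
    <= (ev ord_max ^+ 2)%:C * dot y y.
Proof.
move=> sM evM ev0; have [P [d [uP MP db]]] := symmetric_diagonalization sM evM.
have -> : dot (complexmx M *m y) (complexmx M *m y) =
    dot (P *m y) (diag_mx (\row_i (d i ^+ 2)%:C) *m (P *m y)).
  rewrite (dot_herm _ _ sM) MP -!mulmxA.
  rewrite (mulmxA P) (unitarymxP uP) mul1mx -dot_mull; congr (dot _ _).
  rewrite (mulmxA (diag_mx _)) mulmx_diag; congr (diag_mx _ *m _).
  by apply/rowP => i; rewrite !mxE -rmorphM.
rewrite -(dot_unitary y y uP).
apply: dot_diag_bounds => i; rewrite mxE !lecR.
have /andP[lb ub] := db i.
by rewrite !ler_pXn2r ?nnegrE ?lb ?ub //; lra.
Qed.

(** A nonnegative complex number is real, so the real part taken in [rayleigh] loses nothing. *)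
Lemma rayleighK M (y : 'cV[R[i]]_n.+1) :
    y != 0 -> 0 <= dot y (complexmx M *m y) ->
  (rayleigh M y)%:C * dot y y = dot y (complexmx M *m y).
Proof.
move=> y0 My0; have N0 := dot_gt0 y0.
have -> : rayleigh M y = complex.Re (dot y (complexmx M *m y) / dot y y).
  by rewrite /rayleigh /dot mulmxA.
rewrite RRe_real ?divfK ?gt_eqF //.
by apply: ger0_real; rewrite divr_ge0 // ltW.
Qed.

End Symmetric.

(** * From eigenvectors to a scalar quadratic equation *)

Lemma spdmx_unit (R : realType) n (M : 'M[R]_n) : spdmx M -> M \in unitmx.
Proof.
move=> [_ pM]; rewrite -unitmx_tr -row_free_unit -kermx_eq0.
apply: contraT => /rowV0Pn[v /sub_kermxP vM v0].
have := pM v^T; rewrite trmx_eq0 trmxK => /(_ v0).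
by rewrite -mulmxA -[M *m _]trmxK trmx_mul trmxK vM trmx0 mulmx0 mxE ltxx.
Qed.

Lemma calG_unit (R : realType) n (W : 'M[R]_n) alpha :
  W \in unitmx -> calG W alpha \in unitmx.
Proof. by rewrite !unitmxE det_lblock unitrM => ->. Qed.

(** With [th = lambda - 1], the two block rows of [calA u = lambda calG u] read [th x = - w] and
    [th W y = T x - lambda alpha x]. Pairing the second with [w] and multiplying by [th] eliminates
    [x]. If [y] vanished, so would [w], and then [x]. *)
Lemma precond_eigenpair_quadratic (R : realType) n (W T : 'M[R]_n.+1) alpha
    (lambda : R[i]) (u : 'cV[R[i]]_(n.+1 + n.+1)) :
    W \in unitmx -> W^T = W -> T^T = T -> lambda != 1 ->
    is_eigenpair (precond W T alpha) (lambda, u) ->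
  let y := dsubmx u in
  let w := complexmx (invmx W *m T) *m y in
  y != 0 /\
  (lambda - 1) ^+ 2 * dot y (complexmx T *m y)
    = - dot w (complexmx T *m w) + lambda * alpha%:C * dot w w.
Proof.
move=> uW sW sT l1 [u0 eu] y w; rewrite /= in u0 eu.
set th := lambda - 1; have th0 : th != 0 by rewrite subr_eq0.
have Wc : complexmx W \in unitmx by rewrite map_unitmx.
have Ww : complexmx W *m w = complexmx T *m y.
  by rewrite /w mulmxA -map_mxM mulKVmx.
pose x := usubmx u.
have e : complexmx (calA W T) *m u = lambda *: (complexmx (calG W alpha) *m u).
  by rewrite scalemxAr -eu mulmxA -map_mxM mulKVmx ?calG_unit.
rewrite /complexmx /calA /calG !map_block_mx -[u]vsubmxK -/x -/y in e.
rewrite !mul_block_col scale_col_mx map_mx0 mul0mx addr0 map_mxN mulNmx in e.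
rewrite map_mxZ map_mx1 -scalemxAl mul1mx -!/(complexmx _) -Ww in e.
have [e1 e2] := eq_col_mx e.
have xw : th *: x = - w.
  apply: (can_inj (mulKmx Wc)); rewrite -scalemxAr mulmxN scalerBl scale1r.
  by rewrite -e1 addrAC subrr sub0r.
have ey : th *: (complexmx W *m y) =
    complexmx T *m x - (lambda * alpha%:C) *: x.
  apply/eqP; rewrite scalerBl scale1r subr_eq addrAC e2 scalerDr scalerA.
  by rewrite addrAC subrr add0r.
split.
  apply: contraNneq u0 => y0.
  have w0 : w = 0 by rewrite /w y0 mulmx0.
  move/eqP: xw; rewrite w0 oppr0 scaler_eq0 (negPf th0) /= => /eqP x0.
  by rewrite -[u]vsubmxK -/y -/x x0 y0 col_mx0.
have -> : dot y (complexmx T *m y) = dot w (complexmx W *m y).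
  by rewrite -(dot_herm _ _ sW) Ww dot_herm.
have thTx : th * dot w (complexmx T *m x) = - dot w (complexmx T *m w).
  by rewrite -dotZr scalemxAr xw mulmxN dotNr.
have thx : th * dot w x = - dot w w.
  rewrite -(dotZr w x th) xw; exact: dotNr.
rewrite expr2 -mulrA -(dotZr w _ th) ey dotDr dotNr dotZr mulrBr thTx.
by rewrite [th * (_ * _)]mulrCA thx mulrN opprK.
Qed.

(** The quadratic has real coefficients and no two distinct real roots, so the squared modulus of a
    root is the product of both roots. *)
Lemma quadratic_root_norm (R : realType) (a b c alpha : R) (th : R[i]) :
    0 < a -> 0 < b -> 0 <= c -> 0 < alpha ->
    alpha <= 2 / b * (Num.sqrt (a * (a + c)) - a) ->
    th ^+ 2 * a%:C = - c%:C + (1 + th) * alpha%:C * b%:C ->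
  a * (complex.Re th ^+ 2 + complex.Im th ^+ 2) = c - alpha * b.
Proof.
case: th => p q a0 b0 c0 al0 alb.
rewrite expr2 => /eqP; rewrite eq_complex /= => /andP[/eqP hre /eqP him].
(* The bound on [alpha] rearranges to [alpha b + 2 a <= 2 sqrt (a (a + c))], and squaring gives the
   sign of the discriminant. *)
have disc : (alpha * b) ^+ 2 + 4 * a * (alpha * b) <= 4 * a * c.
  set S := Num.sqrt _ in alb.
  have SS : S ^+ 2 = a * (a + c) by rewrite sqr_sqrtr // mulr_ge0 //; lra.
  have S0 : 0 <= S by exact: sqrtr_ge0.
  have : alpha * b + 2 * a <= 2 * S.
    rewrite mulrAC ler_pdivlMr // in alb; lra.
  have ab0 : 0 < alpha * b by rewrite mulr_gt0.
  move=> h; have : (alpha * b + 2 * a) ^+ 2 <= (2 * S) ^+ 2.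
    by rewrite ler_pXn2r ?nnegrE //; lra.
  rewrite [in X in _ <= X -> _]exprMn SS; nra.
(* Whether the roots are conjugate or equal, their real part is the vertex. *)
have vertex : 2 * a * p = alpha * b.
  have [q0|q0] := eqVneq q 0.
    (* For a real root this square equals the discriminant. *)
    have : (2 * a * p - alpha * b) ^+ 2 <= 0.
      rewrite q0 in hre; nra.
    by rewrite le_eqVlt ltNge sqr_ge0 orbF sqrf_eq0 subr_eq0 => /eqP.
  by apply: (mulIf q0); lra.
have : 2 * a * p * p = alpha * b * p by rewrite vertex.
lra.
Qed.

(** * Estimating the coefficients and the radius *)

Theorem theorem2 (R : realType) (n : nat) (W T : 'M[R]_n.+1)
    (nu mu : 'I_n.+1 -> R) (alpha : R)
    (s : seq (R[i] * 'cV[R[i]]_(n.+1 + n.+1)))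
    (hW : spdmx W) (hT : spsdmx T)
    (hnu : ordered_eigenvalues W nu) (hmu : ordered_eigenvalues T mu)
    (hnu1 : 0 < nu ord0) (hmu1 : 0 <= mu ord0) (hmun : mu ord_max != 0)
    (hs : eigenpair_list (precond W T alpha) s)
    (halpha0 : 0 < alpha) (halpha : (alpha%:E <= alpha_max W T s)%E) :
  forall lambda : R[i], is_eigenvalue (precond W T alpha) lambda ->
    ((complex.Re `|lambda - 1|)%:E
       <= disk_radius alpha (nu ord0) (nu ord_max) (mu ord0) (mu ord_max))%E.
Proof.
(* The eigenvector must come from [s], since [halpha] only concerns the pairs listed there. *)
move=> lambda /(proj2 hs)[[l u] us ll]; rewrite /= in ll; subst l.
have eu := proj1 hs _ us.
have [sW _] := hW; have [sT _] := hT; have uW := spdmx_unit hW.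
rewrite /disk_radius; case: eqVneq => [_|mu1N0]; first by rewrite leey.
have mu1 : 0 < mu ord0 by rewrite lt0r mu1N0.
have mun : 0 < mu ord_max by rewrite (lt_le_trans mu1) // hmu.2.
have nun : 0 < nu ord_max by rewrite (lt_le_trans hnu1) // hnu.2.
(* The centre of the disk is harmless: [Num.sqrt] is nonnegative whatever the sign of its
   argument. *)
rewrite lee_fin normc_def; have [->|l1] := eqVneq lambda 1.
  by rewrite subrr /= expr0n addr0 sqrtr0 sqrtr_ge0.
have /= [] := precond_eigenpair_quadratic uW sW sT l1 eu.
set y := dsubmx u; set w := complexmx (invmx W *m T) *m y => y0 eq_lambda.
have Ww : complexmx W *m w = complexmx T *m y.
  by rewrite /w mulmxA -map_mxM mulKVmx.
have sV : (invmx W)^T = invmx W by rewrite trmx_inv sW.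
have wE : w = complexmx (invmx W) *m (complexmx T *m y).
  by rewrite mulmxA -complexmxM.
have yE : dsubmx u = y by [].
clearbody w; clearbody y.
have bE : dot y (complexmx (T *m (invmx W *m invmx W) *m T) *m y) = dot w w.
  by rewrite !complexmxM -!mulmxA -(dot_herm _ _ sT) -(dot_herm _ _ sV) -wE.
have cE : dot y (complexmx (T *m invmx W *m T *m invmx W *m T) *m y)
    = dot w (complexmx T *m w).
  by rewrite !complexmxM -!mulmxA -(dot_herm _ _ sT) -(dot_herm _ _ sV) -wE.
have N0 := dot_gt0 y0.
have /andP[a_lb _] := rayleigh_bounds y sT hmu.
have /andP[wTw_ge0 wTw_le] := rayleigh_bounds w sT hmu.
(* [T y] and [W w] are the same vector, so bounding its norm both ways compares [w] with [y], which
   bounds [b]. *)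
have /andP[Ty_lb Ty_ub] := norm_mul_bounds y sT hmu hmu1.
have /andP[Ww_lb Ww_ub] := norm_mul_bounds w sW hnu (ltW hnu1).
rewrite Ww in Ww_lb Ww_ub.
have yTy0 : 0 <= dot y (complexmx T *m y).
  by apply: le_trans a_lb; rewrite mulr_ge0 ?ler0c ?dot_ge0.
have wTw0 : 0 <= dot w (complexmx T *m w).
  by apply: le_trans wTw_ge0; rewrite mulr_ge0 ?ler0c ?dot_ge0.
have aP : (coef_a T y)%:C * dot y y = dot y (complexmx T *m y).
  exact: rayleighK y0 yTy0.
have bP : (coef_b W T y)%:C * dot y y = dot w w.
  by rewrite -bE; apply: (rayleighK y0); rewrite bE; apply: dot_ge0.
have cP : (coef_c W T y)%:C * dot y y = dot w (complexmx T *m w).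
  by rewrite -cE; apply: (rayleighK y0); rewrite cE; apply: wTw0.
have scale_le (k k' : R) : (k%:C * dot y y <= k'%:C * dot y y) = (k <= k').
  by rewrite ler_pM2r // lecR.
have amu : mu ord0 <= coef_a T y by rewrite -scale_le aP.
have b_lb : mu ord0 ^+ 2 <= nu ord_max ^+ 2 * coef_b W T y.
  by rewrite -scale_le real_complexM -mulrA bP (le_trans Ty_lb).
have b_ub : nu ord0 ^+ 2 * coef_b W T y <= mu ord_max ^+ 2.
  by rewrite -scale_le real_complexM -mulrA bP (le_trans Ww_lb).
have c_ub : coef_c W T y <= mu ord_max * coef_b W T y.
  by move: wTw_le; rewrite -cP -bP mulrA -real_complexM scale_le.
have c0 : 0 <= coef_c W T y.
  by rewrite -scale_le mul0r cP.
(* Since [mu ord0 > 0], the lower bound on [b] is strict; hence this eigenpair takes part in the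
   minimum [alpha_max]. *)
have b0 : 0 < coef_b W T y.
  rewrite -(pmulr_rgt0 _ (exprn_gt0 2 nun)).
  by rewrite (lt_le_trans _ b_lb) // exprn_gt0.
have al_le : alpha <= alpha_bound W T y.
  rewrite -lee_fin; apply: le_trans halpha _; rewrite -yE.
  apply: (@ge_bigmin_seq _ _ _ s _ (lambda, u) _
    (fun p => (alpha_bound W T (dsubmx p.2))%:E)) => //.
  by rewrite yE y0 gt_eqF.
have a0 : 0 < coef_a T y by exact: lt_le_trans amu.
set a := coef_a T y in aP a0 amu.
set b := coef_b W T y in bP b0 c_ub b_lb b_ub.
set c := coef_c W T y in cP c0 c_ub.
set p := complex.Re (lambda - 1); set q := complex.Im (lambda - 1).
have root_norm : a * (p ^+ 2 + q ^+ 2) = c - alpha * b.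
  apply: (quadratic_root_norm a0 b0 c0 halpha0 al_le).
  apply: (mulIf (lt0r_neq0 N0)).
  rewrite -[LHS]mulrA aP eq_lambda -bP -cP mulrDl mulNr addrCA subrr addr0.
  by congr (_ + _); exact: mulrA.
clearbody a b c p q.
apply: ler_wsqrtr; rewrite -[X in X <= _](mulKf (lt0r_neq0 a0)) root_norm mulrC.
(* This sign allows [a] to be replaced by its lower bound [mu ord0] in the denominator of
   [(c - alpha b) / a]. *)
have d0 : 0 <= c - alpha * b.
  by rewrite -root_norm pmulr_rge0 // addr_ge0 ?sqr_ge0.
(* Chains [c <= mu_n b] with [nu_1^2 b <= mu_n^2]. *)
have c_ub' : nu ord0 ^+ 2 * c <= mu ord_max ^+ 3.
  apply: (@le_trans _ _ (mu ord_max * (nu ord0 ^+ 2 * b))).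
    by rewrite mulrCA ler_wpM2l ?sqr_ge0.
  by rewrite [_ ^+ 3]exprS ler_wpM2l // ltW.
rewrite ler_pdivlMr; last by rewrite !mulr_gt0 ?exprn_gt0.
rewrite mulrAC ler_pdivrMr //.
apply: (@le_trans _ _
  ((c - alpha * b) * (nu ord0 ^+ 2 * nu ord_max ^+ 2) * a)).
  by rewrite -[leRHS]mulrA ler_wpM2l // ler_wpM2l // mulr_ge0 // sqr_ge0.
(* Once [a] is cancelled, the upper bound on [c] and the lower bound on [b] are used separately. *)
rewrite ler_wpM2r ?(ltW a0) // mulrBl lerB //.
  by rewrite mulrA (mulrC c) ler_wpM2r ?sqr_ge0.
have -> : alpha * b * (nu ord0 ^+ 2 * nu ord_max ^+ 2) =
  alpha * (nu ord_max ^+ 2 * b) * nu ord0 ^+ 2 by ring.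
by rewrite ler_wpM2r ?sqr_ge0 // ler_wpM2l // ltW.
Qed.
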